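(* Let $\mathbb{F}$ be a field, $n\geq 1$ an integer, and let $A\in\mathrm{SL}_n(\mathbb{F})$. Then the matrix $A\oplus I_n\in\mathrm{GL}_{2n}(\mathbb{F})$ is the product of three $U_2$-matrices.
   Context: $A\oplus B$ denotes the block-diagonal matrix with diagonal blocks $A$ and $B$. A $U_2$-matrix (unipotent of index $2$) is a matrix $U\in\mathrm{GL}_m(\mathbb{F})$ such that $(U-I_m)^2=0$ (so $I_m$ is a $U_2$-matrix). $\mathrm{SL}_n(\mathbb{F})$ is the group of $n\times n$ matrices with determinant $1$. *)

(* Defs.v *)
From mathcomp Require Import all_boot all_order all_algebra.

Set Implicit Arguments.
Unset Strict Implicit.
Unset Printing Implicit Defensive.

Import GRing.Theory.
Local Open Scope ring_scope.

Definition dsum_mx (F : fieldType) (m n : nat) (A : 'M[F]_m) (B : 'M[F]_n) :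
  'M[F]_(m + n) := block_mx A 0 0 B.

Definition U2_matrix (F : fieldType) (m : nat) (U : 'M[F]_m) : Prop :=
  U \in unitmx /\ (U - 1%:M) *m (U - 1%:M) = 0.

(* Main.v *)
Require Import Defs.
From mathcomp Require Import all_boot all_order all_fingroup all_algebra.
From mathcomp Require Import ring zify.

Set Implicit Arguments.
Unset Strict Implicit.
Unset Printing Implicit Defensive.

Import GRing.Theory.
Local Open Scope ring_scope.

(** Products of k U2-matrices are stable under similarity and under direct
sums. Fitting's decomposition at the eigenvalue 1 gives A ~ T (+) A', with T
unipotent and A' - 1 invertible ([fitting_at_1]), so that A (+) 1 is similar to
(T (+) 1) (+) (A' (+) 1), and the two summands can be treated separately;
moreover det A' = det A = 1.

A unipotent matrix is a product of two U2-matrices ([unipotent_prodU2]): this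
can be checked on one Jordan block, where the factors are the transvections
along the even and along the odd steps of the Jordan chain. This settles T.

If A' is not scalar, then A' = Q P with Q and P unipotent (a theorem of Sourour,
[unipotent_factorable_nonscalar]). As A' - 1 is invertible, A' (+) 1 can be
conjugated so that its upper left block is any prescribed matrix; prescribing P
makes the Schur complement of that block equal to Q. The block factorization is
then a U2-matrix times a block triangular unipotent matrix, and the latter is a
product of two U2-matrices ([dsum1_of_unipotent_factorable]).

If A' = a 1 is scalar of size m, then a is not 1 and a ^ m = 1, and the weight
and shift matrices P, R satisfy P R = a R P, that is, a 1 is a commutator. The
matrix a 1 (+) 1 is similar to the companion matrix of the block polynomial
t^2 - (1 + a) t + a. Right multiplication by a block unitriangular U2-matrix
replaces 1 + a by any block X, and for X = R + P + a P^-1 the result T becomes a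
product of two U2-matrices: the graph of - a^-1 P is a subspace K stable under
T + T^-1 with K (+) T K the whole space, and in a basis adapted to K and
(T - 1) K the matrix T is visibly such a product ([dsum1_of_commutator]). *)

(** * Normalizing matrix identities *)

Lemma addmxE (F : fieldType) m n (A B : 'M[F]_(m, n)) i j :
  (A + B) i j = A i j + B i j.
Proof. by rewrite mxE. Qed.

Lemma oppmxE (F : fieldType) m n (A : 'M[F]_(m, n)) i j : (- A) i j = - A i j.
Proof. by rewrite mxE. Qed.

Lemma scalemxE (F : fieldType) m n c (A : 'M[F]_(m, n)) i j :
  (c *: A) i j = c * A i j.
Proof. by rewrite mxE. Qed.

Lemma zeromxE (F : fieldType) m n i j : (0 : 'M[F]_(m, n)) i j = 0.
Proof. by rewrite mxE. Qed.

(** A noncommutative identity between matrices is proved by expanding both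
sides into linear combinations of words, and comparing these entrywise: the
entries of a word are atoms for [ring]. *)
Ltac mx_expand :=
  rewrite ?(mulmxDl, mulmxDr, mulmxN, mulNmx, mulmx1, mul1mx, mulmx0, mul0mx,
            =^~ scalemxAl, =^~ scalemxAr, mulmxA).
Ltac mx_abel :=
  let i := fresh in let j := fresh in
  apply/matrixP => i j; rewrite ?(addmxE, oppmxE, scalemxE, zeromxE); ring.

(** * Similarity *)

(** The sizes m and n are necessarily equal, but keeping them apart lets
similarity relate matrices whose sizes are equal only propositionally, as
happens when blocks are regrouped. *)
Definition mx_similar (F : fieldType) m n (M : 'M[F]_m) (M' : 'M[F]_n) :=
  exists S : 'M[F]_(m, n), exists S' : 'M[F]_(n, m),
    [/\ S *m S' = 1%:M, S' *m S = 1%:M & M = S *m M' *m S'].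

Section Similarity.
Variable F : fieldType.

Lemma mx_similar_trans m n p (A : 'M[F]_m) (B : 'M[F]_n) (C : 'M[F]_p) :
  mx_similar A B -> mx_similar B C -> mx_similar A C.
Proof.
move=> [S [S' [SS' S'S ->]]] [R [R' [RR' R'R ->]]].
exists (S *m R), (R' *m S'); split; last by rewrite !mulmxA.
- by rewrite mulmxA -(mulmxA S) RR' mulmx1.
- by rewrite mulmxA -(mulmxA R') S'S mulmx1.
Qed.

Lemma mx_similar_unit n (g A B : 'M[F]_n) :
  g \in unitmx -> g *m A = B *m g -> mx_similar A B.
Proof.
move=> gU e; exists (invmx g), g; split; first exact: mulVmx.
  exact: mulmxV.
by rewrite -mulmxA -e mulmxA mulVmx // mul1mx.
Qed.

Lemma mx_similar_refl n (A : 'M[F]_n) : mx_similar A A.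
Proof. by apply: (@mx_similar_unit _ 1%:M); rewrite ?unitmx1 ?mul1mx ?mulmx1. Qed.

Lemma mx_similar_dsum m n m' n' (A : 'M[F]_m) (B : 'M[F]_n)
    (A' : 'M[F]_m') (B' : 'M[F]_n') :
  mx_similar A A' -> mx_similar B B' ->
  mx_similar (dsum_mx A B) (dsum_mx A' B').
Proof.
move=> [S [S' [SS' S'S ->]]] [R [R' [RR' R'R ->]]].
exists (block_mx S 0 0 R), (block_mx S' 0 0 R').
by split; rewrite /dsum_mx !mulmx_block !(mul0mx, mulmx0, addr0, add0r)
  ?SS' ?S'S ?RR' ?R'R -?scalar_mx_block.
Qed.

(** Transports the summand 1 of A (+) 1 along a change of size. *)
Lemma mx_similar1 m n (A : 'M[F]_m) (B : 'M[F]_n) :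
  mx_similar A B -> mx_similar (1%:M : 'M[F]_m) (1%:M : 'M[F]_n).
Proof.
by move=> [S [S' [SS' S'S _]]]; exists S, S'; rewrite mulmx1.
Qed.

Lemma mx_similar_dsum_interchange a b c d (A : 'M[F]_a) (B : 'M[F]_b)
    (C : 'M[F]_c) (D : 'M[F]_d) :
  mx_similar (dsum_mx (dsum_mx A B) (dsum_mx C D))
             (dsum_mx (dsum_mx A C) (dsum_mx B D)).
Proof.
exists (block_mx (block_mx 1%:M 0 0 0) (block_mx 0 0 1%:M 0)
                 (block_mx 0 1%:M 0 0) (block_mx 0 0 0 1%:M)).
exists (block_mx (block_mx 1%:M 0 0 0) (block_mx 0 0 1%:M 0)
                 (block_mx 0 1%:M 0 0) (block_mx 0 0 0 1%:M)).
by split; rewrite /dsum_mx ?(mulmx_block, mul0mx, mulmx0, addr0, add0r, mul1mx,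
  mulmx1, add_block_mx, block_mx0) -?scalar_mx_block.
Qed.

Lemma mx_similar_cast m n (e : (m = n) * (m = n)) (A : 'M[F]_m) :
  mx_similar (castmx e A) A.
Proof.
case: e => e e'; rewrite (eq_irrelevance e' e) {e'}.
by case: n / e; rewrite castmx_id; apply: mx_similar_refl.
Qed.

Lemma mx_similar_dsum0 n (T : 'M[F]_0) (A : 'M[F]_n) :
  mx_similar A (dsum_mx T A).
Proof.
exists (row_mx 0 1%:M), (col_mx 0 1%:M); split.
- by rewrite mul_row_col mulmx1 mulmx0 add0r.
- rewrite mul_col_row !(mulmx0, mulmx1) [RHS]scalar_mx_block.
  by congr block_mx; apply/matrixP; case.
- by rewrite /dsum_mx mul_row_block !mul0mx !add0r !mul1mx mul_row_col
    mulmx1 mulmx0 add0r.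
Qed.

End Similarity.

(** * Products of U2-matrices *)

Section U2Products.
Variable F : fieldType.

(** The invertibility is automatic: if N^2 = 0, then 1 - N is the inverse of
1 + N. *)
Lemma U2_matrixI m (U : 'M[F]_m) :
  (U - 1%:M) *m (U - 1%:M) = 0 -> U2_matrix U.
Proof.
move=> e; split=> //.
have [] // : U \in unitmx /\ (1%:M - (U - 1%:M)) \in unitmx.
apply: mulmx1_unit; rewrite -{1}(subrK 1%:M U); move: (U - 1%:M) e => N e.
by mx_expand; rewrite e; mx_abel.
Qed.

Lemma U2_matrix1 m : U2_matrix (1%:M : 'M[F]_m).
Proof. by apply: U2_matrixI; rewrite subrr mulmx0. Qed.

Lemma U2_matrix_similar m n (S : 'M[F]_(m, n)) (S' : 'M[F]_(n, m)) U :
  S *m S' = 1%:M -> S' *m S = 1%:M -> U2_matrix U -> U2_matrix (S *m U *m S').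
Proof.
move=> SS' S'S [_ e]; apply: U2_matrixI.
have -> : S *m U *m S' - 1%:M = S *m (U - 1%:M) *m S'.
  by rewrite mulmxBr mulmxBl mulmx1 SS'.
by rewrite !mulmxA -(mulmxA _ S') S'S mulmx1 -(mulmxA S) e mulmx0 mul0mx.
Qed.

Lemma dsum_mx_sub1 m n (A : 'M[F]_m) (B : 'M[F]_n) :
  dsum_mx A B - 1%:M = dsum_mx (A - 1%:M) (B - 1%:M).
Proof.
by rewrite /dsum_mx scalar_mx_block opp_block_mx add_block_mx !oppr0 !addr0.
Qed.

Lemma dsum_mx_mul m n (A A' : 'M[F]_m) (B B' : 'M[F]_n) :
  dsum_mx A B *m dsum_mx A' B' = dsum_mx (A *m A') (B *m B').
Proof. by rewrite /dsum_mx mulmx_block !(mul0mx, mulmx0, addr0, add0r). Qed.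

Lemma U2_matrix_dsum m n (A : 'M[F]_m) (B : 'M[F]_n) :
  U2_matrix A -> U2_matrix B -> U2_matrix (dsum_mx A B).
Proof.
move=> [_ eA] [_ eB]; apply: U2_matrixI.
by rewrite dsum_mx_sub1 dsum_mx_mul eA eB /dsum_mx block_mx0.
Qed.

Lemma U2_matrix_upper m n (X : 'M[F]_(m, n)) :
  U2_matrix (block_mx 1%:M X 0 1%:M).
Proof.
apply: U2_matrixI; rewrite scalar_mx_block opp_block_mx add_block_mx !subrr.
by rewrite mulmx_block !(mul0mx, mulmx0, subr0, addr0) block_mx0.
Qed.

Lemma U2_matrix_lower m n (Y : 'M[F]_(n, m)) :
  U2_matrix (block_mx 1%:M 0 Y 1%:M).
Proof.
apply: U2_matrixI; rewrite scalar_mx_block opp_block_mx add_block_mx !subrr.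
by rewrite mulmx_block !(mul0mx, mulmx0, subr0, addr0) block_mx0.
Qed.

Fixpoint prodU2 k m (M : 'M[F]_m) : Prop :=
  if k is k'.+1 then exists U M', [/\ U2_matrix U, prodU2 k' M' & M = U *m M']
  else M = 1%:M.

Lemma prodU2_cons k m (U M : 'M[F]_m) :
  U2_matrix U -> prodU2 k M -> prodU2 k.+1 (U *m M).
Proof. by move=> HU HM; exists U, M. Qed.

Lemma prodU2_rcons k m (U M : 'M[F]_m) :
  U2_matrix U -> prodU2 k M -> prodU2 k.+1 (M *m U).
Proof.
move=> HU; elim: k M => [|k IH] M.
  by move=> ->; exists U, 1%:M; rewrite mul1mx mulmx1.
move=> [V [M' [HV HM ->]]]; rewrite -mulmxA; apply: prodU2_cons => //.
exact: IH.
Qed.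

Lemma prodU2_1 k m : prodU2 k (1%:M : 'M[F]_m).
Proof.
elim: k => //= k IH; exists 1%:M, 1%:M.
by split; rewrite ?mulmx1 //; apply: U2_matrix1.
Qed.

Lemma prodU2S k m (M : 'M[F]_m) : prodU2 k M -> prodU2 k.+1 M.
Proof. by rewrite -{2}(mul1mx M); apply: prodU2_cons; apply: U2_matrix1. Qed.

Lemma prodU2_similar k m n (A : 'M[F]_m) (B : 'M[F]_n) :
  mx_similar A B -> prodU2 k B -> prodU2 k A.
Proof.
move=> [S [S' [SS' S'S ->]]]; elim: k B => [|k IH] B /=.
  by move=> ->; rewrite mulmx1.
move=> [U [M [HU HM ->]]].
exists (S *m U *m S'), (S *m M *m S'); split; [exact: U2_matrix_similar | exact: IH |].
by rewrite !mulmxA -(mulmxA _ S') S'S mulmx1.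
Qed.

Lemma prodU2_dsum k m n (A : 'M[F]_m) (B : 'M[F]_n) :
  prodU2 k A -> prodU2 k B -> prodU2 k (dsum_mx A B).
Proof.
elim: k A B => [|k IH] A B /=.
  by move=> -> ->; rewrite /dsum_mx -scalar_mx_block.
move=> [U [M [HU HM ->]]] [V [N [HV HN ->]]].
exists (dsum_mx U V), (dsum_mx M N); rewrite dsum_mx_mul.
by split=> //; [apply: U2_matrix_dsum | apply: IH].
Qed.

End U2Products.

(** * Unipotent matrices are products of two U2-matrices *)

Section Unipotent.
Variable F : fieldType.

Definition unipotent_mx m (T : 'M[F]_m) := exists k, (T - 1%:M) ^+ k = 0.

Lemma expr_block_lower m n (A : 'M[F]_m) (C : 'M[F]_(n, m)) (D : 'M[F]_n) k :
  exists C', block_mx A 0 C D ^+ k = block_mx (A ^+ k) 0 C' (D ^+ k).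
Proof.
elim: k => [|k [C' IH]].
  by exists 0; rewrite !expr0 -scalar_mx_block.
exists (C *m A ^+ k + D *m C').
by rewrite !exprS IH -!mulmxE mulmx_block !(mul0mx, mulmx0, addr0, add0r).
Qed.

Lemma trmxX m (A : 'M[F]_m) k : (A ^+ k)^T = A^T ^+ k.
Proof.
elim: k => [|k IH]; first by rewrite !expr0 trmx1.
by rewrite exprS exprSr -!mulmxE trmx_mul IH.
Qed.

Lemma unipotent_mx1 m : unipotent_mx (1%:M : 'M[F]_m).
Proof. by exists 1%N; rewrite subrr expr1. Qed.

Lemma unipotent_tr m (T : 'M[F]_m) : unipotent_mx T -> unipotent_mx T^T.
Proof.
move=> [k e]; exists k.
by rewrite -[in LHS](trmx1 F m) -linearB -trmxX e trmx0.
Qed.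

Lemma unipotent_block_lower m n (A : 'M[F]_m) (C : 'M[F]_(n, m)) (D : 'M[F]_n) :
  unipotent_mx A -> unipotent_mx D -> unipotent_mx (block_mx A 0 C D).
Proof.
move=> [a ea] [b eb]; exists ((a + b) * 2)%N.
rewrite scalar_mx_block opp_block_mx add_block_mx !oppr0 !addr0.
rewrite exprM; have [C' ->] := expr_block_lower (A - 1%:M) C (D - 1%:M) (a + b).
rewrite exprD ea mul0r (addnC a) exprD eb mul0r expr2 -mulmxE mulmx_block.
by rewrite !(mul0mx, mulmx0, addr0) block_mx0.
Qed.

Lemma unipotent_block_upper m n (A : 'M[F]_m) (B : 'M[F]_(m, n)) (D : 'M[F]_n) :
  unipotent_mx A -> unipotent_mx D -> unipotent_mx (block_mx A B 0 D).
Proof.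
move=> HA HD; rewrite -[block_mx _ _ _ _]trmxK tr_block_mx trmx0.
by apply/unipotent_tr/unipotent_block_lower; apply: unipotent_tr.
Qed.

(** The part of the nilpotent Jordan block that steps from indices of parity b.
A step changes the parity of the index, so the square of this matrix is 0. *)
Definition step_mx k (b : bool) : 'M[F]_k :=
  \matrix_(i, j) ((odd i == b) && (j == i.+1 :> nat))%:R.

(** The terms of v past index k must vanish because row k - 1 of a Jordan block
of size k steps out of the range. *)
Lemma step_mx_mul k m b (v : nat -> 'rV[F]_m) i :
  (forall i, (k <= i)%N -> v i = 0) ->
  row i (step_mx k b *m \matrix_(i < k) v i) = if odd i == b then v i.+1 else 0.
Proof.
move=> v0; rewrite row_mul mulmx_sum_row.
have [ik|] := ltnP i.+1 k; last first.
  move=> ki; rewrite big1 ?v0 ?if_same // => j _; rewrite !mxE.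
  by rewrite (ltn_eqF (leq_trans (ltn_ord j) ki)) andbF scale0r.
rewrite (bigD1 (Ordinal ik)) //= big1 ?addr0.
  by rewrite !mxE eqxx andbT rowK; case: ifP; rewrite ?scale1r ?scale0r.
move=> j ne; rewrite !mxE.
case: (boolP (j == i.+1 :> nat)) => [/eqP e|_]; last by rewrite andbF scale0r.
by case/eqP: ne; apply: val_inj.
Qed.

Lemma U2_matrix_step k b : U2_matrix (1%:M + step_mx k b).
Proof.
apply: U2_matrixI; rewrite addrC addrA addNr add0r.
apply/matrixP => i j; rewrite !mxE big1 // => l _; rewrite !mxE.
case: (odd i =P b) => [e|]; last by rewrite mul0r.
case: (l =P i.+1 :> nat) => [/= ->|]; last by rewrite mul0r.
by rewrite /= -e; case: (odd i); rewrite mulr0.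
Qed.

Lemma uphalfS i : uphalf i.+1 = (uphalf i + ~~ odd i)%N.
Proof. by rewrite uphalfE /= uphalfE /=; lia. Qed.

(** Write N = T - 1. The chain v N^i of a vector under N has to be adjusted to a
chain b_i on which T acts as E O, where E adds to each even row the next one and
O does the same for odd rows. Applying E O to the rows b_i gives the conditions
b_i N = b_(i+1) for i odd, and b_i N = b_(i+1) + b_(i+2) = b_(i+1) T for i even.
They are solved by b_i = v N^i T^(c - ceil(i/2)) for any c; the value c = k keeps
the exponents nonnegative. *)
Lemma cyclic_basis m (T : 'M[F]_m) k (v : 'rV[F]_m) :
  (T - 1%:M) ^+ k = 0 ->
  exists B : 'M[F]_(k, m),
    (forall i : 'I_k, exists c, row i B = v *m ((T - 1%:M) ^+ i *m T ^+ c)) /\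
    B *m T = (1%:M + step_mx k false) *m (1%:M + step_mx k true) *m B.
Proof.
move=> Nk0; set N := T - 1%:M in Nk0 *.
pose b i := v *m (N ^+ i *m T ^+ (k - uphalf i)).
have b0 i : (k <= i)%N -> b i = 0.
  by move=> ki; rewrite /b -(subnKC ki) exprD Nk0 mul0r mul0mx mulmx0.
have NT : GRing.comm N T.
  by apply: commr_sym; apply: commrB; [exact: commr_refl | exact: commr1].
have bN i : (i < k)%N -> b i *m N = b i.+1 + (if odd i then 0 else b i.+2).
  move=> ik; rewrite /b -mulmxA -[X in _ *m X]mulmxA !mulmxE.
  have -> : T ^+ (k - uphalf i) * N = N * T ^+ (k - uphalf i).
    exact: (commr_sym (commrX _ NT)).
  rewrite mulrA -exprSr; case: ifP => oi.
    by rewrite addr0 uphalfS oi addn0.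
  rewrite -mulmxDr [uphalf i.+2]uphalfS uphalfS /= oi /= addn0 addn1.
  have -> : (k - uphalf i = (k - (uphalf i).+1).+1)%N.
    by rewrite subnSK // uphalfE; lia.
  rewrite [N ^+ i.+2]exprSr -mulrA -mulrDr; congr (_ *m (_ * _)).
  by rewrite exprS /N mulrBl [X in _ - X]mul1r addrC subrK.
exists (\matrix_(i < k) b i); split.
  by move=> i; exists (k - uphalf i)%N; rewrite rowK.
apply/row_matrixP => i.
rewrite -mulmxA [_ *m (\matrix_i _)]mulmxDl mul1mx.
have -> : \matrix_(i < k) b i + step_mx k true *m \matrix_(i < k) b i =
   \matrix_(i < k) (b i + if odd i then b i.+1 else 0).
  apply/row_matrixP => j; rewrite linearD /= step_mx_mul // !rowK.
  by rewrite eqb_id.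
rewrite mulmxDl mul1mx linearD /= rowK.
rewrite (@step_mx_mul _ _ _ (fun i => b i + if odd i then b i.+1 else 0)); last first.
  by move=> j kj; rewrite !b0 ?if_same ?addr0 // ltnW.
rewrite row_mul rowK -[in LHS](subrK 1%:M T) mulmxDr mulmx1 -/N bN //= addrC -addrA.
by case: (odd i); rewrite //= ?addr0 ?add0r.
Qed.

(** The first step of the Jordan decomposition, followed by induction on the
size. Let k + 1 be the nilpotency index of N = T - 1, and choose a row v and a
column phi with v N^k phi <> 0. The chain B starting at v spans a stable
subspace, on which T is a product of two U2-matrices by [cyclic_basis]. The
common kernel of the columns N^j phi is a stable complement: the pairing of B
with these columns is triangular with nonzero diagonal v N^k phi, because
N^(k+1) = 0 and T acts as 1 on the image of N^k. *)
Lemma unipotent_prodU2 m (T : 'M[F]_m) : unipotent_mx T -> prodU2 2 T.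
Proof.
elim/ltn_ind: m T => m IH T uT.
have [k0 k0E] := uT.
have exN : exists k, (T - 1%:M) ^+ k == 0 by exists k0; apply/eqP.
case: (ex_minnP exN) => k /eqP Nk kmin {exN k0 k0E}.
case: k => [|k] in Nk kmin *.
  (* An exponent 0 forces 1 = 0, so m = 0. *)
  have -> : T = 1%:M; last exact: prodU2_1.
  by rewrite -(subrK 1%:M T) -[T - _]mulr1 -(expr0 (T - 1%:M)) Nk mulr0 add0r.
set N := T - 1%:M in Nk kmin *.
have NT : GRing.comm N T.
  by apply: commr_sym; apply: commrB; [exact: commr_refl | exact: commr1].
have NkT c : N ^+ k * T ^+ c = N ^+ k.
  elim: c => [|c IHc]; first by rewrite mulr1.
  rewrite exprSr mulrA IHc -(subrK 1%:M T) -/N mulrDr -exprSr Nk add0r.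
  exact: mulr1.
have /eqP/matrix0Pn[i0 [j0 ne0]] : N ^+ k <> 0.
  by move=> e; have := kmin k; rewrite e eqxx ltnn => /(_ isT).
pose v : 'rV[F]_m := delta_mx 0 i0.
have [B [rowB BT]] := cyclic_basis v Nk.
pose phi : 'cV[F]_m := delta_mx j0 0.
have ge0 j (l : 'I_k.+1) : (l < j)%N -> N ^+ (j + (k - l)) = 0.
  move=> lj; have -> : (j + (k - l) = k.+1 + (j - l.+1))%N by have := ltn_ord l; lia.
  by rewrite exprD Nk mul0r.
(* The columns are taken in reverse order to make B Phi triangular. *)
pose Phi : 'M[F]_(m, k.+1) := \matrix_(i, j) (N ^+ (k - j) *m phi) i 0.
have colPhi j : col j Phi = N ^+ (k - j) *m phi.
  by apply/colP => i; rewrite !mxE.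
have BPhiE (i j : 'I_k.+1) : exists c,
   (B *m Phi) i j = (v *m (N ^+ (i + (k - j)) * T ^+ c) *m phi) 0 0.
  have [c rB] := rowB i; exists c.
  transitivity ((row i B *m col j Phi) 0 0).
    by rewrite !mxE; apply: eq_bigr => l _; rewrite !mxE.
  rewrite rB colPhi mulmxA -[X in X *m phi]mulmxA.
  congr ((_ *m _ *m phi) 0 0).
  rewrite -mulmxA !mulmxE exprD -!mulrA; congr (_ * _).
  exact: (commrX _ (commr_sym (commrX _ NT))).
have BPhi_unit : B *m Phi \in unitmx.
  rewrite unitmxE -det_tr det_trig.
    rewrite unitfE; apply/prodf_neq0 => i _; rewrite mxE.
    have [c ->] := BPhiE i i.
    rewrite subnKC ?NkT; last by rewrite -ltnS.
    by rewrite -rowE -colE !mxE.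
  apply/is_trig_mxP => i j ij; rewrite mxE; have [c ->] := BPhiE j i.
  by rewrite ge0 // mul0r mulmx0 mul0mx mxE.
pose G := Phi *m invmx (B *m Phi).
have BG : B *m G = 1%:M by rewrite mulmxA mulmxV.
pose W := row_base (kermx Phi).
have WPhi : W *m Phi = 0.
  by apply/sub_kermxP; rewrite eq_row_base.
have WG : W *m G = 0 by rewrite mulmxA WPhi mul0mx.
have kerW p (X : 'M[F]_(p, m)) : X *m Phi = 0 -> exists Y, X = Y *m W.
  move=> XPhi; apply/submxP; rewrite eq_row_base; exact/sub_kermxP.
(* 1 - G B is the projection onto the kernel of Phi, which is the row space of W. *)
have [E PE] : exists E, 1%:M - G *m B = E *m W.
  by apply: kerW; rewrite mulmxBl mul1mx -mulmxA /G mulmxKV // subrr.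
have Winj p (X : 'M[F]_(p, \rank (kermx Phi))) : X *m W = 0 -> X = 0.
  by move/eqP; rewrite mulmx_free_eq0 ?row_base_free // => /eqP.
have BE : B *m E = 0.
  by apply: Winj; rewrite -mulmxA -PE mulmxBr mulmx1 mulmxA BG mul1mx subrr.
have WE : W *m E = 1%:M.
  apply/eqP; rewrite -subr_eq0; apply/eqP/Winj.
  by rewrite mulmxBl mul1mx -mulmxA -PE mulmxBr mulmx1 mulmxA WG mul0mx subr0 subrr.
clearbody G W.
have [N' WN] : exists N', W *m N = N' *m W.
  apply: kerW; apply/matrixP => i j; rewrite [RHS]mxE.
  have WN0 (l : 'I_k.+1) : W *m (N ^+ (k - l) *m phi) = 0.
    by rewrite -colPhi colE mulmxA WPhi mul0mx.
  (* N shifts the columns of Phi, and sends the first of them to N^(k+1) phi = 0. *)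
  transitivity ((W *m (N ^+ (k - j).+1 *m phi)) i 0).
    rewrite exprS -mulmxE -(mulmxA N) -colPhi colE !mulmxA -colE.
    by rewrite [RHS]mxE.
  case: j => [[|j] ltj] /=; first by rewrite subn0 Nk mul0mx mulmx0 mxE.
  by rewrite subnSK // (WN0 (Ordinal (ltnW ltj))) mxE.
pose T' := 1%:M + N'.
have WT : W *m T = T' *m W.
  by rewrite -(subrK 1%:M T) -/N mulmxDr mulmxDl WN mulmx1 mul1mx addrC.
have uT' : unipotent_mx T'.
  exists k.+1; rewrite addrC addKr; apply: Winj.
  suff WNc c : W *m N ^+ c = N' ^+ c *m W by rewrite -WNc Nk mulmx0.
  elim: c => [|c IHc]; first by rewrite !expr0 mulmx1 mul1mx.
  by rewrite exprSr -mulmxE mulmxA IHc -mulmxA WN mulmxA mulmxE -exprSr.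
have rk : (\rank (kermx Phi) < m)%N.
  rewrite mxrank_ker ltn_subrL lt0n mxrank_eq0.
  have m_gt0 : (0 < m)%N by apply: leq_ltn_trans (ltn_ord i0).
  rewrite m_gt0 andbT; apply: contraTneq BPhi_unit => ->.
  by rewrite mulmx0 unitmxE det0 unitr0.
apply: (@prodU2_similar _ _ _ _ _ (dsum_mx
  ((1%:M + step_mx k.+1 false) *m (1%:M + step_mx k.+1 true)) T')).
  exists (row_mx G E), (col_mx B W); split.
  - by rewrite mul_row_col -PE addrC subrK.
  - by rewrite mul_col_row BG BE WG WE -scalar_mx_block.
  rewrite /dsum_mx mul_row_block !mulmx0 addr0 add0r mul_row_col.
  rewrite -!mulmxA -WT [_ *m (_ *m B)]mulmxA -BT !mulmxA -mulmxDl -PE.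
  by rewrite addrC subrK mul1mx.
apply: prodU2_dsum (IH _ rk _ uT').
apply: prodU2_cons; first exact: U2_matrix_step.
rewrite -[X in prodU2 1 X]mulmx1.
by apply: prodU2_cons; [exact: U2_matrix_step | exact: prodU2_1].
Qed.

End Unipotent.

(** * Splitting off the generalized eigenspace of the eigenvalue 1 *)

Section Fitting.
Variable F : fieldType.

Lemma unit_with_first_row n (v : 'rV[F]_(1 + n)) :
  v != 0 -> exists2 g : 'M_(1 + n), g \in unitmx & usubmx g = v.
Proof.
move=> nz; have rk : \rank v = 1%N by apply/eqP; rewrite rank_rV nz.
have := mulmx_ebase v; set c := col_ebase v; set g := row_ebase v.
rewrite rk (_ : pid_mx 1 = row_mx 1%:M 0); last first.
  by apply/rowP => j; rewrite !mxE; case: splitP => l; rewrite ?ord1 ?mxE => ->.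
rewrite mul_mx_row mulmx1 mulmx0 [c]mx11_scalar => e.
have c0 : c 0 0 != 0.
  by have := col_ebase_unit v; rewrite unitmxE det_mx11 unitfE.
exists (c 0 0 *: g).
  by rewrite unitmxZ ?unitfE // row_ebase_unit.
rewrite -e -[g]vsubmxK mul_row_col mul0mx addr0 mul_scalar_mx.
by rewrite scale_col_mx col_mxKu.
Qed.

(** By induction: a fixed row vector of A gives A ~ [1, 0; y, C], and C is
similar to T (+) A' by induction. The part of y in front of A' can be cleared
by a further conjugation, because A' - 1 is invertible; the part in front of T
is absorbed into a larger unipotent block. *)
Lemma fitting_at_1 n (A : 'M[F]_n) :
  exists k m (T : 'M[F]_k) (A' : 'M[F]_m),
    [/\ mx_similar A (dsum_mx T A'), unipotent_mx T, A' - 1%:M \in unitmx &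
        \det A' = \det A].
Proof.
elim: n A => [|n IH] A.
  exists 0, 0, A, A; split=> //.
  - exact: mx_similar_dsum0.
  - by exists 0; apply/matrixP; case.
  - by rewrite unitmxE det_mx00 unitr1.
have [uA|] := boolP (A - 1%:M \in unitmx).
  exists 0, n.+1, 1%:M, A; split=> //; first exact: mx_similar_dsum0.
  exact: unipotent_mx1.
rewrite unitmxE unitfE negbK => /det0P[v nz vA].
have {}vA : v *m A = v.
  by apply/eqP; rewrite -subr_eq0 -{2}(mulmx1 v) -mulmxBr vA.
have [g gU gv] := unit_with_first_row nz.
set C := g *m (A : 'M_(1 + n)) *m invmx g.
have CE : C = block_mx 1%:M 0 (dlsubmx C) (drsubmx C).
  rewrite -[LHS]submxK; suff e : usubmx C = row_mx 1%:M 0.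
    by rewrite /ulsubmx /ursubmx e row_mxKl row_mxKr.
  rewrite /C -!mul_usub_mx gv vA -gv mul_usub_mx mulmxV //.
  by rewrite scalar_mx_block /block_mx col_mxKu.
have sAC : mx_similar A C.
  by apply: (@mx_similar_unit _ _ g) => //; rewrite /C mulmxKV.
have dC : \det (drsubmx C) = \det A.
  have <- : \det C = \det A.
    by rewrite !det_mulmx mulrAC -det_mulmx mulmxV // det1 mul1r.
  by rewrite [in RHS]CE det_lblock det1 mul1r.
have [k [m [T [A' [[S [S' [SS' S'S e]]] uT uA' dA']]]]] := IH (drsubmx C).
pose x := S' *m dlsubmx C.
exists (1 + k)%N, m, (block_mx 1%:M 0 (usubmx x) T), A'; split=> //; last first.
- by rewrite dA' dC.
- by apply: unipotent_block_lower => //; apply: unipotent_mx1.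
apply: mx_similar_trans sAC _; rewrite CE e.
have s1 : mx_similar (block_mx 1%:M 0 (dlsubmx C) (S *m dsum_mx T A' *m S'))
                     (block_mx 1%:M 0 x (dsum_mx T A')).
  exists (block_mx 1%:M 0 0 S), (block_mx 1%:M 0 0 S').
  split; rewrite !mulmx_block !(mul0mx, mulmx0, mul1mx, mulmx1, addr0, add0r).
  - by rewrite SS' -scalar_mx_block.
  - by rewrite S'S -scalar_mx_block.
  - by rewrite /x mulmxA SS' mul1mx.
apply: mx_similar_trans s1 _.
pose z := invmx (A' - 1%:M) *m dsubmx x.
(* Conjugating by [1, 0; w, 1] with w = (0, z) changes x into x + w - (T (+) A') w. *)
have zE : A' *m z = dsubmx x + z.
  apply/eqP; rewrite -subr_eq -{2}(mul1mx z) -mulmxBl mulmxA mulmxV // mul1mx //.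
pose w : 'cV[F]_(k + m) := col_mx 0 z.
have s2 : mx_similar (block_mx 1%:M 0 x (dsum_mx T A'))
    (block_mx 1%:M (row_mx 0 0) (col_mx (usubmx x) 0) (block_mx T 0 0 A')).
  apply: (@mx_similar_unit _ _ (block_mx 1%:M 0 w 1%:M)).
    by rewrite unitmxE det_lblock !det1 mul1r unitr1.
  rewrite !mulmx_block row_mx0 !(mul0mx, mulmx0, mul1mx, mulmx1, addr0, add0r).
  congr block_mx; rewrite /w mul_block_col !(mulmx0, mul0mx, addr0, add0r).
  by rewrite -{1}(vsubmxK x) !add_col_mx zE !(add0r, addr0) addrC.
apply: mx_similar_trans s2 _.
rewrite block_mxA /dsum_mx col_mx0 row_mx0.
exact: mx_similar_cast.
Qed.

End Fitting.

(** * Nonscalar matrices of determinant 1 *)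

Section NonScalar.
Variable F : fieldType.

(** If all unit vectors are eigenvectors then A is diagonal, and if their sums are
eigenvectors too then the diagonal entries agree. *)
Lemma non_eigenrow n (A : 'M[F]_n) :
  ~~ is_scalar_mx A -> exists v : 'rV_n, ~~ (v *m A <= v)%MS.
Proof.
move=> nsA; case: n A nsA => [A /negP[]|n A nsA].
  by apply/is_scalar_mxP; exists 0; apply/matrixP; case.
have [dA|] := boolP (is_diag_mx A); last first.
  move=> ndA.
  have /existsP[i /existsP[j /andP[ij nz]]] :
      [exists i, exists j, (i != j) && (A i j != 0)].
    apply: contraNT ndA => /existsPn h; apply/is_diag_mxP => i j ij.
    by have /existsPn/(_ j) := h i; rewrite ij /= negbK => /eqP.
  exists (delta_mx 0 i); apply: contra nz => /sub_rVP[a e].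
  by have := congr1 (fun M : 'rV_n.+1 => M 0 j) e; rewrite -rowE !mxE eqxx /= [j == i]eq_sym
    (negbTE ij) mulr0 => ->.
have /existsP[i ne] : [exists i, A i i != A ord0 ord0].
  apply: contraNT nsA => /existsPn h; apply/is_scalar_mxP; exists (A ord0 ord0).
  apply/matrixP => i j; rewrite !mxE; case: eqP => [<-|/eqP ij].
    by have := h i; rewrite negbK => /eqP.
  by move/is_diag_mxP: dA => /(_ i j ij).
have ni0 : i != ord0 by apply: contraNneq ne => ->.
exists (delta_mx 0 i + delta_mx 0 ord0); apply: contra ne => /sub_rVP[a e].
have e1 := congr1 (fun M : 'rV_n.+1 => M 0 i) e.
have e2 := congr1 (fun M : 'rV_n.+1 => M 0 ord0) e.
move/is_diag_mxP: dA => dA.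
move: e1 e2; rewrite mulmxDl -!rowE !mxE !eqxx /= [ord0 == i]eq_sym (negbTE ni0).
rewrite (dA i ord0 ni0) (dA ord0 i) 1?eq_sym //.
by rewrite !(addr0, add0r) mulr1 => -> ->.
Qed.

Lemma row_mul_onto n (x : 'rV[F]_n) (c : 'M[F]_1) :
  x != 0 -> exists z : 'cV_n, x *m z = c.
Proof.
move=> /matrix0Pn[i [j nz]]; rewrite ord1 in nz.
exists ((c 0 0 / x 0 j) *: delta_mx j 0).
rewrite -scalemxAr -colE; apply/matrixP => a b; rewrite !ord1 !mxE.
by rewrite divfK.
Qed.

Lemma row_mul_ker n (x : 'rV[F]_n) :
  (1 < n)%N -> exists2 z : 'cV_n, z != 0 & x *m z = 0.
Proof.
move=> n1; have : (0 < \rank (kermx x^T))%N.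
  by rewrite mxrank_ker subn_gt0 (leq_ltn_trans (rank_leq_col _)).
rewrite lt0n mxrank_eq0 => /rowV0Pn[u /sub_kermxP ux nz].
exists u^T; first by rewrite -(inj_eq (@trmx_inj _ _ _)) trmxK trmx0.
by apply: (@trmx_inj _ _ _); rewrite trmx_mul trmxK ux trmx0.
Qed.

Lemma unipotent_similar n (g A B : 'M[F]_n) :
  g \in unitmx -> g *m A = B *m g -> unipotent_mx B -> unipotent_mx A.
Proof.
move=> gU e [k Bk]; exists k.
have e1 : g *m (A - 1%:M) = (B - 1%:M) *m g.
  by rewrite mulmxBr mulmxBl e mulmx1 mul1mx.
suff ek : g *m (A - 1%:M) ^+ k = (B - 1%:M) ^+ k *m g.
  by rewrite -[LHS](mulKmx gU) ek Bk mul0mx mulmx0.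
elim: k {Bk} => [|k IH]; first by rewrite !expr0 mulmx1 mul1mx.
by rewrite !exprSr -!mulmxE mulmxA IH -mulmxA e1 mulmxA.
Qed.

Definition unipotent_factorable n (A : 'M[F]_n) :=
  exists Q P, [/\ unipotent_mx Q, unipotent_mx P & A = Q *m P].

Lemma unipotent_factorable_similar n (g A B : 'M[F]_n) :
  g \in unitmx -> g *m A = B *m g ->
  unipotent_factorable B -> unipotent_factorable A.
Proof.
move=> gU e [Q [P [uQ uP eB]]].
have gconj X : g *m (invmx g *m X *m g) = X *m g by rewrite !mulmxA mulmxV // mul1mx.
exists (invmx g *m Q *m g), (invmx g *m P *m g); split.
- exact: unipotent_similar gU (gconj Q) uQ.
- exact: unipotent_similar gU (gconj P) uP.
by rewrite -[LHS](mulKmx gU) e eB !mulmxA mulmxK.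
Qed.

(** Elimination with pivot 1: the matrix is [1, 0; y, 1] [1, x; 0, S], and the
factors Q and P of S can be inserted into the two triangular matrices. *)
Lemma unipotent_factorable_pivot n (x : 'rV[F]_n) (y : 'cV[F]_n) (S : 'M[F]_n) :
  unipotent_factorable S ->
  unipotent_factorable (block_mx 1%:M x y (S + y *m x)).
Proof.
move=> [Q [P [uQ uP ->]]].
exists (block_mx 1%:M 0 y Q), (block_mx 1%:M x 0 P); split.
- by apply: unipotent_block_lower => //; apply: unipotent_mx1.
- by apply: unipotent_block_upper => //; apply: unipotent_mx1.
by rewrite mulmx_block !(mul0mx, mulmx0, mul1mx, mulmx1, addr0) addrC.
Qed.

Lemma lower_conj n (a : 'M[F]_1) (x : 'rV[F]_n) y D z :
  block_mx 1%:M 0 z 1%:M *m block_mx a x y D =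
  block_mx (a - x *m z) x (z *m a + y - (z *m x + D) *m z) (z *m x + D)
    *m block_mx 1%:M 0 z 1%:M.
Proof.
by rewrite !mulmx_block !(mul0mx, mulmx0, mul1mx, mulmx1, add0r, addr0) !subrK.
Qed.

Lemma lower_unit n (z : 'cV[F]_n) : block_mx (1%:M : 'M_1) 0 z 1%:M \in unitmx.
Proof. by rewrite unitmxE det_lblock !det1 mul1r unitr1. Qed.

Lemma det_similar n (g A B : 'M[F]_n) :
  g \in unitmx -> g *m A = B *m g -> \det A = \det B.
Proof.
rewrite unitmxE unitfE => gU e; have := congr1 determinant e.
by rewrite !det_mulmx mulrC => /(mulIf gU).
Qed.

Lemma det_pivot n (x : 'rV[F]_n) (y : 'cV[F]_n) (S : 'M[F]_n) :
  \det (block_mx 1%:M x y (S + y *m x)) = \det S.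
Proof.
have -> : block_mx 1%:M x y (S + y *m x) =
    block_mx 1%:M 0 y 1%:M *m block_mx 1%:M x 0 S.
  by rewrite mulmx_block !(mul0mx, mulmx0, mul1mx, mulmx1, addr0) addrC.
by rewrite det_mulmx det_lblock det_ublock !det1 !mul1r.
Qed.

(** Sourour's argument. In a basis starting with a vector that is not an
eigenvector, the first row of A is (c, x) with x <> 0. Conjugation by
[1, 0; z, 1] replaces c by c - x z, so one may assume that the pivot c is 1, and
the Schur complement S has determinant 1. If S is not scalar, induction
applies. If S = a 1 has size at least 2, a further conjugation with z <> 0 and
x z = 0 keeps the pivot and changes S into a (1 + z x), which is not scalar as
z x is a nonzero matrix of square 0. In size at most 1 the determinant makes S
trivial. *)
Lemma unipotent_factorable_nonscalar n (A : 'M[F]_n) :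
  \det A = 1 -> ~~ is_scalar_mx A -> unipotent_factorable A.
Proof.
elim: n A => [|n IH] A dA nsA.
  by case/negP: nsA; apply/is_scalar_mxP; exists 0; apply/matrixP; case.
have [v nv] := non_eigenrow nsA.
have nz : v != 0 by apply: contraNneq nv => ->; rewrite mul0mx.
have [g gU gv] := unit_with_first_row nz.
pose C := g *m (A : 'M_(1 + n)) *m invmx g.
have gA : g *m A = C *m g by rewrite /C mulmxKV.
apply: (unipotent_factorable_similar gU gA).
have dC : \det C = 1.
  by rewrite -(det_similar gU gA).
pose x := ursubmx C.
have nx : x != 0.
  apply: contraNneq nv => x0; apply/sub_rVP; exists (ulsubmx C 0 0).
  rewrite -gv mul_usub_mx gA -mul_usub_mx -[usubmx C]hsubmxK.
  rewrite -/(ursubmx C) -/(ulsubmx C) -/x x0 -[g in LHS]vsubmxK mul_row_col mul0mx addr0.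
  by rewrite {1}[ulsubmx C]mx11_scalar mul_scalar_mx.
have [z xz] := row_mul_onto (ulsubmx C - 1%:M) nx.
pose D := z *m x + drsubmx C.
pose y := z *m ulsubmx C + dlsubmx C - D *m z.
have simC : block_mx 1%:M 0 z 1%:M *m C
    = block_mx 1%:M x y D *m block_mx 1%:M 0 z 1%:M.
  by rewrite -[C in LHS]submxK lower_conj -/x xz subKr.
apply: (unipotent_factorable_similar (lower_unit z) simC).
have [S DE] : exists S, D = S + y *m x by exists (D - y *m x); rewrite subrK.
clearbody x D y.
have dS : \det S = 1.
  by rewrite -(det_pivot x y) -DE -(det_similar (lower_unit z) simC).
rewrite DE {D DE C dC gA z xz simC}.
have [nsS|] := boolP (~~ is_scalar_mx S).
  by apply: unipotent_factorable_pivot; apply: IH.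
rewrite negbK => /is_scalar_mxP[a Sa].
have [n1|n_le1] := ltnP 1 n; last first.
  apply: unipotent_factorable_pivot; exists 1%:M, 1%:M.
  split; [exact: unipotent_mx1 | exact: unipotent_mx1 |].
  rewrite mulmx1; case: n n_le1 S Sa dS {IH A dA nsA v nv nz g gU gv x nx y} => [|[|//]] _ S.
    by move=> _ _; apply/matrixP; case.
  by move=> ->; rewrite det_scalar expr1 => ->.
have a0 : a != 0.
  apply: contra_eqN dS => /eqP a0; rewrite Sa a0 det_scalar expr0n.
  by rewrite (gtn_eqF (ltnW n1)) eq_sym oner_eq0.
have [z nz' xz] := row_mul_ker x n1.
pose y' := z + y - (z *m x + (S + y *m x)) *m z.
(* Hence the new Schur complement is a (1 + z x). *)
have DE : z *m x + (S + y *m x) = (a%:M + a *: (z *m x)) + y' *m x.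
  have zxz : z *m x *m z = 0 by rewrite -mulmxA xz mulmx0.
  have yxz : y *m x *m z = 0 by rewrite -mulmxA xz mulmx0.
  rewrite /y' Sa !mulmxDl zxz yxz mul_scalar_mx add0r addr0 mulNmx -scalemxAl.
  mx_abel.
have sim := lower_conj 1%:M x y (S + y *m x) z.
rewrite xz subr0 mulmx1 -/y' DE in sim.
apply: (unipotent_factorable_similar (lower_unit z) sim).
apply: unipotent_factorable_pivot; apply: IH.
  by rewrite -(det_pivot x y') -(det_similar (lower_unit z) sim) det_pivot.
apply/negP => /is_scalar_mxP[b e].
have {}e : a *: (z *m x) = (b - a)%:M.
  by rewrite -[LHS](addKr a%:M) e addrC raddfB.
have : (b - a) *: z = 0.
  by rewrite -mul_scalar_mx -e -scalemxAl -mulmxA xz mulmx0 scaler0.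
move/eqP; rewrite scaler_eq0 (negbTE nz') orbF => /eqP ba.
move/eqP: e; rewrite ba raddf0 scaler_eq0 (negbTE a0) /= => /eqP zx0.
have /matrix0Pn[i [j zi]] := nz'; have /matrix0Pn[k [l xl]] := nx.
rewrite (ord1 j) in zi; rewrite (ord1 k) in xl.
have := congr1 (fun M : 'M_n => M i l) zx0; rewrite !mxE big_ord1 => /eqP.
by rewrite mulf_eq0 (negbTE zi) (negbTE xl).
Qed.

(** Conjugating A (+) 1 by [1, 1; 0, 1] [1, 0; K, 1] gives the upper left block
A + K (A - 1), which is P for the K chosen here, and the conjugate is
[1, 0; 1 - Q, 1] [P, 1 - P; 0, Q] because Q P = A. *)
Lemma dsum1_of_unipotent_factorable m (A : 'M[F]_m) :
  unipotent_factorable A -> A - 1%:M \in unitmx ->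
  prodU2 3 (dsum_mx A (1%:M : 'M_m)).
Proof.
move=> [Q [P [uQ uP AE]]] uA.
pose K := (P - A) *m invmx (A - 1%:M).
have KE : K *m A = P - A + K.
  by apply/eqP; rewrite -subr_eq -{2}(mulmx1 K) -mulmxBr /K mulmxKV.
pose g : 'M[F]_(m + m) := block_mx (1%:M + K) 1%:M K 1%:M.
have gU : g \in unitmx.
  have -> : g = block_mx 1%:M 1%:M 0 1%:M *m block_mx 1%:M 0 K 1%:M.
    by rewrite mulmx_block !(mul0mx, mulmx0, mul1mx, mulmx1, add0r, addr0).
  by rewrite unitmxE det_mulmx det_ublock det_lblock !det1 !mul1r unitr1.
pose L : 'M[F]_(m + m) := block_mx 1%:M 0 (1%:M - Q) 1%:M.
pose R : 'M[F]_(m + m) := block_mx P (1%:M - P) 0 Q.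
apply: (@prodU2_similar _ _ _ _ _ (L *m R)).
  apply: (mx_similar_unit gU).
  rewrite /dsum_mx !mulmx_block !(mul0mx, mulmx0, mul1mx, mulmx1, addr0, add0r).
  rewrite !(mulmxDl, mulmxDr, mulmx1, mul1mx, mulNmx, mulmxN) -AE KE.
  congr block_mx; mx_abel.
apply: prodU2_cons; first exact: U2_matrix_lower.
by apply: unipotent_prodU2; apply: unipotent_block_upper.
Qed.

End NonScalar.

(** * Scalar matrices of determinant 1 *)

Section Scalar.
Variable F : fieldType.

(** M is the companion matrix of t^2 - (1 + a) t + a = (t - 1) (t - a), hence
similar to a 1 (+) 1 as a <> 1. It differs from T, the companion matrix of
t^2 - X t + a, by a U2-matrix on the right. Let e be the block column
[1; - a^-1 P]. The relation P R = a R P gives (T + T^-1 - 2) e = e Z, and since R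
and P are invertible, e and (T - 1) e form a basis. In this basis the matrix T
is [1, Z; 1, 1 + Z] = [1, 0; 1, 1] [1, Z; 0, 1]. *)
Lemma dsum1_of_commutator m (a : F) (P P' R R' : 'M[F]_m) :
  a != 0 -> a != 1 -> P *m P' = 1%:M -> R *m R' = 1%:M ->
  P *m R = a *: (R *m P) -> prodU2 3 (dsum_mx (a%:M : 'M_m) (1%:M : 'M_m)).
Proof.
move=> a0 a1 PP' RR' PR.
have P'P := mulmx1C PP'.
have P'R : P' *m R = a^-1 *: (R *m P').
  rewrite -[RHS]mul1mx -P'P -scalemxAr !mulmxA -(mulmxA P') PR.
  by rewrite -scalemxAr -scalemxAl scalerK // -!mulmxA PP' mulmx1.
have XPP' n (X : 'M_(n, m)) : X *m P *m P' = X by rewrite -mulmxA PP' mulmx1.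
have XP'P n (X : 'M_(n, m)) : X *m P' *m P = X by rewrite -mulmxA P'P mulmx1.
have XPR n (X : 'M_(n, m)) : X *m P *m R = a *: (X *m R *m P).
  by rewrite -mulmxA PR -scalemxAr mulmxA.
have XP'R n (X : 'M_(n, m)) : X *m P' *m R = a^-1 *: (X *m R *m P').
  by rewrite -mulmxA P'R -scalemxAr mulmxA.
pose M : 'M[F]_(m + m) := block_mx 0 (- a%:M) 1%:M ((1 + a)%:M).
pose X := R + P + a *: P'.
pose T : 'M[F]_(m + m) := block_mx 0 (- a%:M) 1%:M X.
pose Z := a^-1 *: R + P + P' - 2%:R%:M.
have MS : mx_similar (dsum_mx (a%:M : 'M_m) (1%:M : 'M_m)) M.
  apply: (@mx_similar_unit _ _ (block_mx 1%:M (- a%:M) (- 1%:M) 1%:M)).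
    have -> : block_mx 1%:M (- a%:M) (- 1%:M) 1%:M =
       block_mx 1%:M 0 (- 1%:M) 1%:M *m
       block_mx 1%:M (- a%:M) 0 (1 - a)%:M :> 'M[F]_(m + m).
      rewrite mulmx_block !(mul0mx, mulmx0, mul1mx, mulmx1, add0r, addr0).
      by rewrite mulNmx mul1mx opprK raddfB addrC subrK.
    rewrite unitmxE det_mulmx det_ublock det_lblock !det1 !mul1r det_scalar.
    by rewrite unitrX // unitfE subr_eq0 eq_sym.
  rewrite /dsum_mx !mulmx_block !(mul0mx, mulmx0, mul1mx, mulmx1, add0r, addr0).
  rewrite !mulmxN !mulNmx !mul1mx !mulmx1.
  congr block_mx.
    by rewrite opprK.
    rewrite raddfD /=; mx_abel.
    rewrite !raddfD /=; mx_abel.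
have TS : mx_similar T (block_mx 1%:M 0 1%:M 1%:M *m block_mx 1%:M Z 0 1%:M).
  (* The block columns of S are [1; - a^-1 P] and its image under T - 1. *)
  pose S : 'M[F]_(m + m) := block_mx 1%:M (P - 1%:M) (- (a^-1 *: P))
     (- (a^-1 *: (P *m (P - 1%:M))) - a^-1 *: (R *m P)).
  have SU : S \in unitmx.
    have -> : S = block_mx 1%:M 0 (- (a^-1 *: P)) 1%:M *m
                  block_mx 1%:M (P - 1%:M) 0 (- (a^-1 *: (R *m P))).
      rewrite mulmx_block !(mul0mx, mulmx0, mul1mx, mulmx1, add0r, addr0).
      by rewrite mulNmx -scalemxAl.
    rewrite unitmxE det_mulmx det_ublock det_lblock !det1 !mul1r -unitmxE.
    rewrite -scaleNr unitmxZ ?unitfE ?oppr_eq0 ?invr_eq0 // unitmx_mul.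
    by case/mulmx1_unit: PP' => ->; case/mulmx1_unit: RR' => ->.
  exists S, (invmx S); split; [exact: mulmxV | exact: mulVmx |].
  suff -> : S *m (block_mx 1%:M 0 1%:M 1%:M *m block_mx 1%:M Z 0 1%:M) = T *m S.
    by rewrite mulmxK.
  rewrite !mulmx_block !(mul0mx, mulmx0, mul1mx, mulmx1, add0r, addr0).
  rewrite /Z /X -[2%:R%:M]scalemx1 -[a%:M]scalemx1.
  do ?[rewrite ?(mulmxDl, mulmxDr, mulmxN, mulNmx, mulmx1, mul1mx, scalerDr, scalerN,
       =^~ scalemxAl, =^~ scalemxAr, mulmxA, XPR, XP'R, PR, P'R, XPP', XP'P, PP', P'P)].
  congr block_mx; apply/matrixP => i j;
    rewrite ?(addmxE, oppmxE, scalemxE, zeromxE); by field.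
apply: (prodU2_similar MS).
have -> : M = T *m block_mx 1%:M ((1 + a)%:M - X) 0 1%:M.
  rewrite mulmx_block !(mul0mx, mulmx0, mul1mx, mulmx1, add0r, addr0).
  by rewrite subrK.
apply: prodU2_rcons; first exact: U2_matrix_upper.
apply: (prodU2_similar TS).
apply: prodU2_cons; first exact: U2_matrix_lower.
rewrite -[X in prodU2 1 X]mulmx1.
by apply: prodU2_cons; [exact: U2_matrix_upper | exact: prodU2_1].
Qed.

(** P is the diagonal matrix with entries a^m, ..., a^2, a, and R is the cyclic
shift. The relation P R = a R P compares consecutive weights; at the point where
the shift wraps around it uses a^m = 1. *)
Lemma dsum1_of_scalar m (a : F) :
  (0 < m)%N -> a ^+ m = 1 -> a != 1 ->
  prodU2 3 (dsum_mx (a%:M : 'M_m) (1%:M : 'M_m)).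
Proof.
move=> m0 am a1.
have a0 : a != 0.
  by apply: contra_eqN am => /eqP ->; rewrite expr0n gtn_eqF // eq_sym oner_eq0.
pose d : 'rV[F]_m := \row_i a ^+ (m - i).
pose d' : 'rV[F]_m := \row_i a ^- (m - i).
pose s := perm (@ordS_inj m).
apply: (@dsum1_of_commutator _ _ (diag_mx d) (diag_mx d') (perm_mx s) (perm_mx s^-1%g)) => //.
- rewrite mulmx_diag -diag_const_mx; congr diag_mx; apply/rowP => i.
  by rewrite !mxE mulfV ?expf_neq0.
- by rewrite -perm_mxM mulgV perm_mx1.
apply/matrixP => i j; rewrite mul_diag_mx mul_mx_diag !mxE.
case: (s i =P j) => [<-|]; last by rewrite mulr0 mul0r mulr0.
rewrite mulr1 mul1r permE -exprS /=.
have [lt|le] := ltnP i.+1 m; first by rewrite modn_small // subnSK.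
have im : i.+1 = m by apply/eqP; rewrite eqn_leq le ltn_ord.
have -> : (m - i = 1)%N by lia.
by rewrite im modnn subn0 [RHS]exprS am mulr1.
Qed.

End Scalar.

(** * The stable factorization *)

Lemma dsum1_of_sub1_unit (F : fieldType) m (A : 'M[F]_m) :
  \det A = 1 -> A - 1%:M \in unitmx -> prodU2 3 (dsum_mx A (1%:M : 'M_m)).
Proof.
move=> dA uA.
have [/is_scalar_mxP[a Aa]|nsA] := boolP (is_scalar_mx A); last first.
  by apply: dsum1_of_unipotent_factorable uA; apply: unipotent_factorable_nonscalar.
have [m0|m_gt0] := posnP m.
  have -> : A = 1%:M by apply/matrixP => i; have := ltn_ord i; rewrite {2}m0.
  by rewrite /dsum_mx -scalar_mx_block; apply: prodU2_1.
rewrite Aa; apply: dsum1_of_scalar => //.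
  by rewrite -dA Aa det_scalar.
apply: contraTneq uA => a1.
by rewrite Aa a1 -raddfB subrr unitmxE det_scalar expr0n gtn_eqF // unitr0.
Qed.

Theorem theorem1p8 (F : fieldType) (n : nat) (hn : (1 <= n)%N)
    (A : 'M[F]_n) (hA : \det A = 1) :
  exists U V W : 'M[F]_(n + n),
    [/\ U2_matrix U, U2_matrix V, U2_matrix W &
        dsum_mx A (1%:M : 'M[F]_n) = U *m V *m W].
Proof.
have [k [m [T [A' [sA uT uA' dA']]]]] := fitting_at_1 A.
have : prodU2 3 (dsum_mx A (1%:M : 'M[F]_n)).
  apply: (prodU2_similar (mx_similar_dsum sA (mx_similar1 sA))).
  rewrite [1%:M]scalar_mx_block.
  apply: (prodU2_similar (mx_similar_dsum_interchange _ _ _ _)).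
  apply: prodU2_dsum; last by apply: dsum1_of_sub1_unit; rewrite ?dA'.
  apply: prodU2S; apply: prodU2_dsum (prodU2_1 _ _ _).
  exact: unipotent_prodU2.
move=> [U [_ [HU [V [_ [HV [W [_ [HW -> ->]] ->]]]] ->]]].
by exists U, V, W; rewrite mulmx1 mulmxA.
Qed.
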